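(* Let $\mathsf L\in\{\mathsf N_\preccurlyeq,\mathsf{NN}_\preccurlyeq,\mathsf{NT}_\preccurlyeq,\mathsf{NW}_\preccurlyeq,\mathsf{NC}_\preccurlyeq,\mathsf{NA}_\preccurlyeq,\mathsf{NNA}_\preccurlyeq\}$ and let $\mathsf{H.L}$ be the corresponding hypersequent calculus. For every formula $A$, if (the hypersequent $\Rightarrow A$) is derivable in $\mathsf{H.L}$, then $A$ is valid in all $\mathsf L$-models.
   Context: Language: formulas $A ::= p \mid \bot \mid A\to A \mid A \preccurlyeq A$ over a countable set $Atm$ of atoms; $\top,\neg,\wedge,\vee$ defined as usual. A neighbourhood model is $\langle W,N,V\rangle$ with $W\ne\emptyset$, $V:Atm\to\mathcal P(W)$, $N:W\to\mathcal P(\mathcal P(W))$ with $\emptyset\notin N(w)$. Forcing: $w\Vdash p$ iff $w\in V(p)$; $w\not\Vdash\bot$; $w\Vdash B\to C$ iff $w\Vdash B$ implies $w\Vdash C$; $w\Vdash B\preccurlyeq C$ iff for all $\alpha\in N(w)$, if some $v\in\alpha$ forces $C$ then some $u\in\alpha$ forces $B$. Validity in a model: forced at all worlds. Conditions (for all $w$): (N) $N(w)\ne\emptyset$; (T) some $\alpha\in N(w)$ contains $w$; (W) $N(w)\ne\emptyset$ and every $\alpha\in N(w)$ contains $w$; (C) $\{w\}\in N(w)$ and every $\alpha\in N(w)$ contains $w$; (A) if $\alpha\in N(w)$ and $v\in\alpha$ then $N(v)=N(w)$. $\mathsf L$-models: $\mathsf N_\preccurlyeq$: all; $\mathsf{NN}_\preccurlyeq$: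 (N); $\mathsf{NT}_\preccurlyeq$: (T); $\mathsf{NW}_\preccurlyeq$: (W); $\mathsf{NC}_\preccurlyeq$: (C); $\mathsf{NA}_\preccurlyeq$: (A); $\mathsf{NNA}_\preccurlyeq$: (N) and (A). Hypersequents: a block $[\Sigma\lhd A]$ consists of a finite multiset $\Sigma$ of formulas and a formula $A$; a sequent with blocks $\Gamma\Rightarrow\Delta$ has $\Gamma$ a finite multiset of formulas and $\Delta$ a finite multiset of formulas and blocks; a hypersequent is a finite multiset $\Gamma_1\Rightarrow\Delta_1\mid\dots\mid\Gamma_n\Rightarrow\Delta_n$ of sequents with blocks (components). Rules ($\mathcal G$ denotes the remaining components): init: $\mathcal G\mid\Gamma,p\Rightarrow p,\Delta$; $\bot_L$: $\mathcal G\mid\Gamma,\bot\Rightarrow\Delta$; $\to_L$: from $\mathcal G\mid\Gamma,A\to B,B\Rightarrow\Delta$ and $\mathcal G\mid\Gamma,A\to B\Rightarrow\Delta,A$ infer $\mathcal G\mid\Gamma,A\to B\Rightarrow\Delta$; $\to_R$: from $\mathcal G\mid\Gamma,A\Rightarrow\Delta,A\to B,B$ infer $\mathcal G\mid\Gamma\Rightarrow\Delta,A\to B$; $\preccurlyeq_L$: from $\mathcal G\mid\Gamma,A\preccurlyeq B\Rightarrow\Delta,[B,\Sigma\lhd C]$ and $\mathcal G\mid\Gamma,A\preccurlyeq B\Rightarrow\Delta,[\Sigma\lhd C],[\Sigma\lhd A]$ infer $\mathcal G\mid\Gamma,A\preccurlyeq B\Rightarrow\Delta,[\Sigma\lhd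 C]$; $\preccurlyeq_R$: from $\mathcal G\mid\Gamma\Rightarrow\Delta,A\preccurlyeq B,[A\lhd B]$ infer $\mathcal G\mid\Gamma\Rightarrow\Delta,A\preccurlyeq B$; jp: from $\mathcal G\mid\Gamma\Rightarrow\Delta,[\Sigma\lhd A]\mid A\Rightarrow\Sigma$ infer $\mathcal G\mid\Gamma\Rightarrow\Delta,[\Sigma\lhd A]$; N: from $\mathcal G\mid\Gamma\Rightarrow\Delta,[\bot\lhd\top]$ infer $\mathcal G\mid\Gamma\Rightarrow\Delta$; T: from $\mathcal G\mid\Gamma,A\preccurlyeq B\Rightarrow\Delta,B$ and $\mathcal G\mid\Gamma,A\preccurlyeq B\Rightarrow\Delta,[\bot\lhd A]$ infer $\mathcal G\mid\Gamma,A\preccurlyeq B\Rightarrow\Delta$; W: from $\mathcal G\mid\Gamma\Rightarrow\Delta,[\Sigma\lhd A],\Sigma$ infer $\mathcal G\mid\Gamma\Rightarrow\Delta,[\Sigma\lhd A]$; C: from $\mathcal G\mid\Gamma,A\preccurlyeq B\Rightarrow\Delta,B$ and $\mathcal G\mid\Gamma,A\preccurlyeq B,A\Rightarrow\Delta$ infer $\mathcal G\mid\Gamma,A\preccurlyeq B\Rightarrow\Delta$; $\mathrm A_L$: from $\mathcal G\mid\Gamma,A\preccurlyeq B\Rightarrow\Delta\mid\Omega,A\preccurlyeq B\Rightarrow\Theta$ infer $\mathcal G\mid\Gamma,A\preccurlyeq B\Rightarrow\Delta\mid\Omega\Rightarrow\Theta$; $\mathrm A_R$: from $\mathcal G\mid\Gamma\Rightarrow\Delta,A\preccurlyeq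 B\mid\Omega\Rightarrow\Theta,A\preccurlyeq B$ infer $\mathcal G\mid\Gamma\Rightarrow\Delta,A\preccurlyeq B\mid\Omega\Rightarrow\Theta$. Calculi: $\mathsf{H.N}=\{\mathrm{init},\bot_L,\to_L,\to_R,\preccurlyeq_L,\preccurlyeq_R,\mathrm{jp}\}$; $\mathsf{H.NN}=\mathsf{H.N}+$N; $\mathsf{H.NT}=\mathsf{H.N}+$T; $\mathsf{H.NW}=\mathsf{H.N}+$T,W; $\mathsf{H.NC}=\mathsf{H.N}+$W,C; $\mathsf{H.NA}=\mathsf{H.N}+\mathrm A_L,\mathrm A_R$; $\mathsf{H.NNA}=\mathsf{H.NN}+\mathrm A_L,\mathrm A_R$. The calculus for $\mathsf NX_\preccurlyeq$ is $\mathsf{H.N}X$. *)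

(* Defs.v *)
From HB Require Import structures.
From mathcomp Require Import all_boot finmap multiset.
From mathcomp Require Import boolp classical_sets.

Set Implicit Arguments.
Unset Strict Implicit.
Unset Printing Implicit Defensive.

Local Open Scope classical_set_scope.

Inductive form (Atm : Type) : Type :=
| Var of Atm
| Bot
| Imp of form Atm & form Atm
| Pref of form Atm & form Atm.

Arguments Bot {Atm}.

Declare Scope form_scope.
Delimit Scope form_scope with form.
Bind Scope form_scope with form.
Notation "⊥" := Bot : form_scope.
Notation "A → B" := (Imp A B)
  (at level 99, B at level 200, right associativity) : form_scope.
Notation "A ≼ B" := (Pref A B) (at level 70, no associativity) : form_scope.
Notation "⊤" := (Imp Bot Bot) : form_scope.

(* {mset T} requires a choiceType, hence this encoding of formulas as trees. *)
Section FormChoice.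
Variable Atm : choiceType.

Fixpoint form_encode (A : form Atm) : GenTree.tree Atm :=
  match A with
  | Var p => GenTree.Leaf p
  | Bot => GenTree.Node 0 [::]
  | Imp B C => GenTree.Node 1 [:: form_encode B; form_encode C]
  | Pref B C => GenTree.Node 2 [:: form_encode B; form_encode C]
  end.

Fixpoint form_decode (t : GenTree.tree Atm) : option (form Atm) :=
  match t with
  | GenTree.Leaf p => Some (Var p)
  | GenTree.Node 0 [::] => Some Bot
  | GenTree.Node 1 [:: b; c] =>
      if (form_decode b, form_decode c) is (Some B, Some C)
      then Some (Imp B C) else None
  | GenTree.Node 2 [:: b; c] =>
      if (form_decode b, form_decode c) is (Some B, Some C)
      then Some (Pref B C) else None
  | _ => None
  end.

Lemma form_encodeK : pcancel form_encode form_decode.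
Proof. by elim=> [p||B IHB C IHC|B IHB C IHC] //=; rewrite IHB IHC. Qed.

HB.instance Definition _ := Choice.copy (form Atm) (pcan_type form_encodeK).

End FormChoice.

Local Open Scope form_scope.

Record model (Atm : Type) := Model {
  world :> Type;
  nbh : world -> set (set world);
  valuation : Atm -> set world;
  world_inhabited : inhabited world;
  nbh_nonempty : forall w, ~ nbh w set0
}.

Fixpoint forces (Atm : Type) (M : model Atm) (w : M) (A : form Atm) : Prop :=
  match A with
  | Var p => valuation p w
  | Bot => False
  | Imp B C => forces w B -> forces w C
  | Pref B C => forall a : set M, nbh w a ->
      (exists2 v, a v & forces v C) -> (exists2 u, a u & forces u B)
  end.

Definition valid (Atm : Type) (M : model Atm) (A : form Atm) : Prop :=
  forall w : M, forces w A.

Definition condN (Atm : Type) (M : model Atm) : Prop :=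
  forall w : M, exists a, nbh w a.
Definition condT (Atm : Type) (M : model Atm) : Prop :=
  forall w : M, exists2 a, nbh w a & a w.
Definition condW (Atm : Type) (M : model Atm) : Prop :=
  forall w : M, (exists a, nbh w a) /\ (forall a, nbh w a -> a w).
Definition condC (Atm : Type) (M : model Atm) : Prop :=
  forall w : M, nbh w [set w] /\ (forall a, nbh w a -> a w).
Definition condA (Atm : Type) (M : model Atm) : Prop :=
  forall (w : M) a v, nbh w a -> a v -> nbh v = nbh w.

Inductive logic := LN | LNN | LNT | LNW | LNC | LNA | LNNA.

Definition model_of (Atm : Type) (L : logic) (M : model Atm) : Prop :=
  match L with
  | LN => True
  | LNN => condN M
  | LNT => condT M
  | LNW => condW M
  | LNC => condC M
  | LNA => condA M
  | LNNA => condN M /\ condA M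
  end.

(* The rules that H.L has in addition to those of H.N. *)
Definition has_N (L : logic) : bool :=
  match L with LNN | LNNA => true | _ => false end.
Definition has_T (L : logic) : bool :=
  match L with LNT | LNW => true | _ => false end.
Definition has_W (L : logic) : bool :=
  match L with LNW | LNC => true | _ => false end.
Definition has_C (L : logic) : bool :=
  match L with LNC => true | _ => false end.
Definition has_A (L : logic) : bool :=
  match L with LNA | LNNA => true | _ => false end.

Local Open Scope mset_scope.

Section Hypersequents.
Variable Atm : choiceType.

Definition block := ({mset (form Atm)} * form Atm)%type.

Definition item := (form Atm + block)%type.

Definition sequent := ({mset (form Atm)} * {mset item})%type.

Definition hypersequent := {mset sequent}.

Definition Sequent (Γ : {mset (form Atm)}) (Δ : {mset item}) : sequent := (Γ, Δ).
Definition fml (A : form Atm) : item := inl A.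
Definition blk (Σ : {mset (form Atm)}) (A : form Atm) : item := inr (Σ, A).

Definition fmls (Σ : {mset (form Atm)}) : {mset item} :=
  seq_mset [seq fml A | A <- Σ].

Local Notation "Γ ⇒ Δ" := (Sequent Γ Δ) (at level 70, no associativity).

Implicit Types (p : Atm) (A B C : form Atm) (Γ Σ Ω : {mset (form Atm)}).
Implicit Types (Δ Θ : {mset item}) (G : hypersequent).

Inductive derivable (L : logic) : hypersequent -> Prop :=
| r_init G Γ Δ p :
    derivable L (G `+` [mset Γ `+` [mset Var p] ⇒ Δ `+` [mset fml (Var p)]])
| r_botL G Γ Δ :
    derivable L (G `+` [mset Γ `+` [mset ⊥] ⇒ Δ])
| r_impL G Γ Δ A B :
    derivable L (G `+` [mset Γ `+` [mset A → B] `+` [mset B] ⇒ Δ]) ->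
    derivable L (G `+` [mset Γ `+` [mset A → B] ⇒ Δ `+` [mset fml A]]) ->
    derivable L (G `+` [mset Γ `+` [mset A → B] ⇒ Δ])
| r_impR G Γ Δ A B :
    derivable L (G `+`
      [mset Γ `+` [mset A] ⇒ Δ `+` [mset fml (A → B)] `+` [mset fml B]]) ->
    derivable L (G `+` [mset Γ ⇒ Δ `+` [mset fml (A → B)]])
| r_prefL G Γ Δ Σ A B C :
    derivable L (G `+`
      [mset Γ `+` [mset A ≼ B] ⇒ Δ `+` [mset blk ([mset B] `+` Σ) C]]) ->
    derivable L (G `+`
      [mset Γ `+` [mset A ≼ B] ⇒ Δ `+` [mset blk Σ C] `+` [mset blk Σ A]]) ->
    derivable L (G `+` [mset Γ `+` [mset A ≼ B] ⇒ Δ `+` [mset blk Σ C]])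
| r_prefR G Γ Δ A B :
    derivable L (G `+`
      [mset Γ ⇒ Δ `+` [mset fml (A ≼ B)] `+` [mset blk [mset A] B]]) ->
    derivable L (G `+` [mset Γ ⇒ Δ `+` [mset fml (A ≼ B)]])
| r_jp G Γ Δ Σ A :
    derivable L (G `+` [mset Γ ⇒ Δ `+` [mset blk Σ A]]
                   `+` [mset [mset A] ⇒ fmls Σ]) ->
    derivable L (G `+` [mset Γ ⇒ Δ `+` [mset blk Σ A]])
| r_N G Γ Δ :
    has_N L ->
    derivable L (G `+` [mset Γ ⇒ Δ `+` [mset blk [mset ⊥] ⊤]]) ->
    derivable L (G `+` [mset Γ ⇒ Δ])
| r_T G Γ Δ A B :
    has_T L ->
    derivable L (G `+` [mset Γ `+` [mset A ≼ B] ⇒ Δ `+` [mset fml B]]) ->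
    derivable L (G `+` [mset Γ `+` [mset A ≼ B] ⇒ Δ `+` [mset blk [mset ⊥] A]]) ->
    derivable L (G `+` [mset Γ `+` [mset A ≼ B] ⇒ Δ])
| r_W G Γ Δ Σ A :
    has_W L ->
    derivable L (G `+` [mset Γ ⇒ Δ `+` [mset blk Σ A] `+` fmls Σ]) ->
    derivable L (G `+` [mset Γ ⇒ Δ `+` [mset blk Σ A]])
| r_C G Γ Δ A B :
    has_C L ->
    derivable L (G `+` [mset Γ `+` [mset A ≼ B] ⇒ Δ `+` [mset fml B]]) ->
    derivable L (G `+` [mset Γ `+` [mset A ≼ B] `+` [mset A] ⇒ Δ]) ->
    derivable L (G `+` [mset Γ `+` [mset A ≼ B] ⇒ Δ])
| r_AL G Γ Δ Ω Θ A B :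
    has_A L ->
    derivable L (G `+` [mset Γ `+` [mset A ≼ B] ⇒ Δ]
                   `+` [mset Ω `+` [mset A ≼ B] ⇒ Θ]) ->
    derivable L (G `+` [mset Γ `+` [mset A ≼ B] ⇒ Δ] `+` [mset Ω ⇒ Θ])
| r_AR G Γ Δ Ω Θ A B :
    has_A L ->
    derivable L (G `+` [mset Γ ⇒ Δ `+` [mset fml (A ≼ B)]]
                   `+` [mset Ω ⇒ Θ `+` [mset fml (A ≼ B)]]) ->
    derivable L (G `+` [mset Γ ⇒ Δ `+` [mset fml (A ≼ B)]] `+` [mset Ω ⇒ Θ]).

End Hypersequents.

(* Main.v *)
(** A block [Σ ◁ A] is read as the formula ⋁Σ ≼ A, and a hypersequent as "some component is
    forced throughout the model". For the logics with condition (A), (A) only makes the truth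
    value of a ≼-formula constant on worlds with the same neighbourhood system, so "throughout
    the model" is replaced by "throughout K", where K is a set of worlds closed under passing
    to elements of neighbourhoods: all worlds in general, and the worlds sharing the
    neighbourhood system of a given world under (A). Each rule preserves this reading. *)
Require Import Defs.
From mathcomp Require Import all_boot finmap multiset.
From mathcomp Require Import boolp classical_sets.

Set Implicit Arguments.
Unset Strict Implicit.
Unset Printing Implicit Defensive.

Local Open Scope mset_scope.

Section MultisetQuantifiers.
Variables (T : choiceType) (P : T -> Prop).
Implicit Types X Y : {mset T}.

Definition all_mset X : Prop := forall x, x \in X -> P x.

Definition some_mset X : Prop := exists2 x, x \in X & P x.

Lemma all_mset0 : all_mset mset0.
Proof. by move=> x; rewrite in_mset0. Qed.

Lemma all_msetD X Y : all_mset (X `+` Y) = (all_mset X /\ all_mset Y).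
Proof.
apply/propext; split=> [h|[hX hY] x].
- by split=> x xXY; apply: h; rewrite in_msetD xXY ?orbT.
- by rewrite in_msetD => /orP[/hX|/hY].
Qed.

Lemma all_mset1 y : all_mset [mset y] = P y.
Proof.
by apply/propext; split=> [|Py x /mset1P->]; first by apply; rewrite mset11.
Qed.

Lemma some_msetD X Y : some_mset (X `+` Y) = (some_mset X \/ some_mset Y).
Proof.
apply/propext; split=> [[x]|[] [x xX Px]].
- by rewrite in_msetD => /orP[xX|xY] Px; [left | right]; exists x.
- by exists x => //; rewrite in_msetD xX.
- by exists x => //; rewrite in_msetD xX orbT.
Qed.

Lemma some_mset1 y : some_mset [mset y] = P y.
Proof.
by apply/propext; split=> [[x /mset1P->]|Py] //; exists y; rewrite ?mset11.
Qed.

End MultisetQuantifiers.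

Section Interpretation.
Variables (Atm : choiceType) (M : model Atm).
Implicit Types (w : M) (K : set M).

(** [some_mset] stands in for the disjunction of [Σ], so no ordering of the multiset has to be
    chosen. *)
Definition forces_item w (i : item Atm) : Prop :=
  match i with
  | inl A => forces w A
  | inr (Σ, A) => forall a, nbh w a -> (exists2 v, a v & forces v A) ->
      exists2 u, a u & some_mset (forces u) Σ
  end.

Definition forces_sequent w (s : sequent Atm) : Prop :=
  all_mset (forces w) s.1 -> some_mset (forces_item w) s.2.

Definition holds_on K (H : hypersequent Atm) : Prop :=
  some_mset (fun s => forall w, K w -> forces_sequent w s) H.

Lemma some_fmls w (Σ : {mset (form Atm)}) :
  some_mset (forces_item w) (fmls Σ) = some_mset (forces w) Σ.
Proof.
apply/propext; split=> [[i]|[B BΣ wB]].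
- by rewrite (perm_mem (perm_eq_seq_mset _)) => /mapP[B BΣ ->] wB; exists B.
- by exists (fml B) => //; rewrite (perm_mem (perm_eq_seq_mset _)); apply: map_f.
Qed.

Lemma condW_condT : condW M -> condT M.
Proof. by move=> cW w; have [[a wa] /(_ _ wa)] := cW w; exists a. Qed.

Lemma condC_condW : condC M -> condW M.
Proof. by move=> cC w; have [w1 wN] := cC w; split=> //; exists [set w]%classic. Qed.

Lemma has_N_condN L : has_N L -> model_of L M -> condN M.
Proof. by case: L => //= _ []. Qed.

Lemma has_T_condT L : has_T L -> model_of L M -> condT M.
Proof. by case: L => //= _; apply: condW_condT. Qed.

Lemma has_W_condW L : has_W L -> model_of L M -> condW M.
Proof. by case: L => //= _; apply: condC_condW. Qed.

Lemma has_C_condC L : has_C L -> model_of L M -> condC M.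
Proof. by case: L. Qed.

Lemma has_A_condA L : has_A L -> model_of L M -> condA M.
Proof. by case: L => //= _ []. Qed.

Lemma holds_onP K G s :
  holds_on K (G `+` [mset s]) <->
  holds_on K G \/ (forall w, K w -> forces_sequent w s).
Proof. by rewrite /holds_on some_msetD some_mset1. Qed.

Definition mset_simpl :=
  (all_msetD, all_mset1, some_msetD, some_mset1, some_fmls).

(** Induction on the derivation. Closure of [K] serves jp, whose new component is evaluated at
    worlds inside a neighbourhood; constancy of [nbh] on [K] serves the two A rules. *)
Lemma derivable_holds_on L K (H : hypersequent Atm) :
  model_of L M ->
  (forall w a v, K w -> nbh w a -> a v -> K v) ->
  (has_A L -> forall v w, K v -> K w -> nbh v = nbh w) ->
  derivable L H -> holds_on K H.
Proof.
move=> ML Kclosed KA; elim=> {H}.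
- move=> G Γ Δ p; apply/holds_onP; right=> w _.
  by rewrite /forces_sequent /= !mset_simpl => -[]; right.
- move=> G Γ Δ; apply/holds_onP; right=> w _.
  by rewrite /forces_sequent /= !mset_simpl => -[].
- move=> G Γ Δ A B _ /holds_onP[g|h1] _ /holds_onP[g'|h2]; apply/holds_onP;
    try by left.
  right=> w Kw; have {}h1 := h1 w Kw; rewrite /forces_sequent /= !mset_simpl in h1.
  have {}h2 := h2 w Kw; rewrite /forces_sequent /= !mset_simpl in h2.
  rewrite /forces_sequent /= !mset_simpl => -[wΓ wAB].
  by have [//|/wAB wB] := h2 (conj wΓ wAB); apply: h1.
- move=> G Γ Δ A B _ /holds_onP[g|h]; apply/holds_onP; first by left.
  right=> w Kw; have {}h := h w Kw; rewrite /forces_sequent /= !mset_simpl in h.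
  (* Where [A] fails, the implication holds vacuously. *)
  rewrite /forces_sequent /= !mset_simpl => wΓ; have [wA|nA] := EM (forces w A); last by right.
  by have [[|]|wB] := h (conj wΓ wA); [left | right | right].
- move=> G Γ Δ Σ A B C _ /holds_onP[g|h1] _ /holds_onP[g'|h2]; apply/holds_onP;
    try by left.
  right=> w Kw; have {}h1 := h1 w Kw; rewrite /forces_sequent /= !mset_simpl in h1.
  have {}h2 := h2 w Kw; rewrite /forces_sequent /= !mset_simpl in h2.
  rewrite /forces_sequent /= !mset_simpl => wΓ.
  have [|wBC] := h1 wΓ; first by left.
  have [//|wA] := h2 wΓ; right=> a wa aC.
  (* If the witness from the first premise forces [B], then [A ≼ B] puts a world forcing [A] into
     [a], and the block [[Σ ◁ A]] of the second premise applies. *)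
  have [u au] := wBC a wa aC; rewrite !mset_simpl => -[uB|]; last by exists u.
  by apply: wA => //; apply: wΓ.2 => //; exists u.
- move=> G Γ Δ A B _ /holds_onP[g|h]; apply/holds_onP; first by left.
  right=> w Kw; have {}h := h w Kw; rewrite /forces_sequent /= !mset_simpl in h.
  rewrite /forces_sequent /= !mset_simpl => /h[//|wAB]; right=> a wa /(wAB a wa)[u au].
  by rewrite !mset_simpl; exists u.
- move=> G Γ Δ Σ A _ /holds_onP[//|h]; apply/holds_onP.
  right=> w Kw; rewrite /forces_sequent /= !mset_simpl.
  (* The component [A ⇒ Σ] is forced at [v] too, so the world forcing [A] itself forces a member of
     [Σ]. *)
  move=> _; right=> a wa [v av vA]; exists v => //.
  have := h v (Kclosed w a v Kw wa av).
  by rewrite /forces_sequent /= !mset_simpl; apply.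
- move=> G Γ Δ hN _ /holds_onP[g|h]; apply/holds_onP; first by left.
  right=> w Kw; have {}h := h w Kw; rewrite /forces_sequent /= !mset_simpl in h.
  move=> /h[//|wN]; have [a wa] := has_N_condN hN ML w.
  (* Any world of [a] forces [⊤], so the block [[⊥ ◁ ⊤]] would yield a world forcing [⊥]. *)
  have [v av] : exists v, a v.
    apply: contrapT => a0; apply: (@nbh_nonempty _ M w).
    suff <- : a = set0 by [].
    by apply/seteqP; split=> // v av; apply: a0; exists v.
  have [|u au] := wN a wa; first by exists v.
  by rewrite mset_simpl.
- move=> G Γ Δ A B hT _ /holds_onP[g|h1] _ /holds_onP[g'|h2]; apply/holds_onP;
    try by left.
  right=> w Kw; have {}h1 := h1 w Kw; rewrite /forces_sequent /= !mset_simpl in h1.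
  have {}h2 := h2 w Kw; rewrite /forces_sequent /= !mset_simpl in h2.
  rewrite /forces_sequent /= !mset_simpl => wΓ.
  have [//|wB] := h1 wΓ; have [//|wA] := h2 wΓ.
  (* As [w] lies in [a] and forces [B], some world of [a] forces [A]; then [[⊥ ◁ A]] is
     contradictory. *)
  have [a wa aw] := has_T_condT hT ML w.
  have [|u au] := wA a wa; last by rewrite mset_simpl.
  by apply: wΓ.2 => //; exists w.
- move=> G Γ Δ Σ A hW _ /holds_onP[g|h]; apply/holds_onP; first by left.
  right=> w Kw; have {}h := h w Kw; rewrite /forces_sequent /= !mset_simpl in h.
  rewrite /forces_sequent /= !mset_simpl => /h[//|wΣ]; right=> a wa _; exists w => //.
  by apply: (has_W_condW hW ML w).2.
- move=> G Γ Δ A B hC _ /holds_onP[g|h1] _ /holds_onP[g'|h2]; apply/holds_onP;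
    try by left.
  right=> w Kw; have {}h1 := h1 w Kw; rewrite /forces_sequent /= !mset_simpl in h1.
  have {}h2 := h2 w Kw; rewrite /forces_sequent /= !mset_simpl in h2.
  rewrite /forces_sequent /= !mset_simpl => wΓ.
  have [//|wB] := h1 wΓ; apply: h2; split=> //.
  (* In the neighbourhood [{w}], the world forcing [A] can only be [w]. *)
  have [w1 _] := has_C_condC hC ML w.
  by have [|u -> //] := wΓ.2 _ w1; exists w.
- move=> G Γ Δ Ω Θ A B /KA KN _ /holds_onP[g|h]; apply/holds_onP; first by left.
  have [KAB|nAB] := EM (forall w, K w -> forces w (Pref A B)).
    right=> w Kw; have {}h := h w Kw; rewrite /forces_sequent /= !mset_simpl in h.
    by move=> wΩ; apply: h; split=> //; apply: KAB.
  left; apply/holds_onP; right=> w Kw.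
  rewrite /forces_sequent /= !mset_simpl => -[_ wAB].
  by case: nAB => v Kv /=; rewrite (KN v w).
- move=> G Γ Δ Ω Θ A B /KA KN _ /holds_onP[g|h]; apply/holds_onP; first by left.
  have [KAB|nAB] := EM (forall w, K w -> forces w (Pref A B)).
    left; apply/holds_onP; right=> w Kw.
    by rewrite /forces_sequent /= !mset_simpl => _; right; apply: KAB.
  right=> w Kw; have {}h := h w Kw; rewrite /forces_sequent /= !mset_simpl in h.
  move=> /h[//|wAB].
  by case: nAB => v Kv /=; rewrite (KN v w).
Qed.

End Interpretation.

Theorem theorem5p2 (Atm : countType) (L : logic) (A : form Atm) :
  derivable L [mset Sequent mset0 [mset fml A]]%mset ->
  forall M : model Atm, model_of L M -> valid M A.
Proof.
move=> dA M ML w.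
(* The guard [has_A L] makes [K] the whole model for logics without (A), so one definition covers
   both cases. *)
pose K : set M := fun v => has_A L -> nbh v = nbh w.
have : holds_on K [mset Sequent mset0 [mset fml A]].
  apply: derivable_holds_on dA => // [v a u Kv va au hA|hA u v Ku Kv].
    by rewrite (has_A_condA hA ML va au); apply: Kv.
  by rewrite Ku ?Kv.
rewrite /holds_on !mset_simpl => /(_ w (fun=> erefl)).
by rewrite /forces_sequent /= !mset_simpl; apply; apply: all_mset0.
Qed.
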